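(* Let $G$ be a connected vertex-transitive graph and let $p\in[0,1]$. Let $\mathbb{P}$ denote the law of $p$-percolation on $G$. Assume that $G$ satisfies the triangle condition at $p$, i.e. for some vertex $v$ of $G$, $$\sum_{x,y\in G}\mathbb{P}(v\leftrightarrow x)\,\mathbb{P}(x\leftrightarrow y)\,\mathbb{P}(y\leftrightarrow v)<\infty .$$ Then $G$ satisfies the open triangle condition at $p$, i.e. $$\lim_{R\to\infty}\ \max_{w\notin B(v,R)}\ \sum_{x,y\in G}\mathbb{P}(v\leftrightarrow x)\,\mathbb{P}(x\leftrightarrow y)\,\mathbb{P}(y\leftrightarrow w)=0 .$$
   Context: $G$ is an undirected connected graph with countable vertex set, and $x\in G$ means that $x$ is a vertex of $G$. $G$ is vertex-transitive if for any two vertices $v,w$ there is a graph automorphism of $G$ taking $v$ to $w$. $p$-percolation on $G$ (bond percolation) is the random subgraph in which each edge of $G$ is independently declared open with probability $p$ and closed with probability $1-p$; $\mathbb{P}$ is the corresponding product probability measure. For vertices $x,y$, the event $x\leftrightarrow y$ is that there is a path of open edges from $x$ to $y$; by convention $x\leftrightarrow x$ always holds, so $\mathbb{P}(x\leftrightarrow x)=1$. $B(v,R)$ is the ball around $v$ of radius $R$ in the graph (shortest path) distance of $G$. By transitivity, the triangle sum does not depend on the choice of $v$, nor does the open triangle condition. The sums are sums of non-negative terms; the maximum over $w\notin B(v,R)$ is understood as a supremum, equal to $0$ if no such $w$ exists. *)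

(* Defs.v *)
From HB Require Import structures.
From mathcomp Require Import all_boot all_order all_algebra finmap.
From mathcomp Require Import all_classical all_reals all_analysis.
Import Order.TTheory GRing.Theory Num.Theory.
Import numFieldNormedType.Exports.

Set Implicit Arguments.
Unset Strict Implicit.
Unset Printing Implicit Defensive.

Local Open Scope classical_set_scope.
Local Open Scope ring_scope.

Record graph (V : countType) := Graph {
  adj : rel V;
  adj_sym : symmetric adj;
  adj_irrefl : irreflexive adj }.

Section Graphs.
Context (V : countType).

(* The walks from x to y along r, each given without its starting point x, so
   that [size s] is the number of steps; [::] is the trivial walk from x to x. *)
Definition walks (r : rel V) (x y : V) : set (seq V) :=
  [set s | path r x s /\ last x s = y].

Definition linked (r : rel V) (x y : V) : Prop := walks r x y !=set0.

Variable G : graph V.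

Definition connected_graph : Prop := forall x y, linked (adj G) x y.

Definition automorphism (f : V -> V) : Prop :=
  bijective f /\ forall x y, adj G (f x) (f y) = adj G x y.

Definition vertex_transitive : Prop :=
  forall v w, exists f, automorphism f /\ f v = w.

(* The default value 0 is only taken when x and y are not connected in G. *)
Definition gdist (x y : V) : nat :=
  xget 0%N [set n | (exists2 s, walks (adj G) x y s & size s = n) /\
                    (forall s, walks (adj G) x y s -> (n <= size s)%N)].

Definition gball (v : V) (n : nat) : set V := [set w | (gdist v w <= n)%N].

(* An undirected edge is the unordered pair of its endpoints. *)
Definition edge : Type :=
  {e : {fset V} | `[< exists x y, adj G x y /\ e = [fset x; y]%fset >]}.

(* [o e = true] means that the edge e is open. *)
Definition config : Type := edge -> bool.

(* The events "e is open" generate the product sigma-algebra on [config]. *)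
Definition edge_events : set (set config) :=
  [set [set o : config | o e] | e in [set: edge]].

Definition config_space := g_sigma_algebraType edge_events.

(* P is the product over the edges of Bernoulli(p) measures, i.e. it has the
   product values on all finite-dimensional cylinders; this determines P. *)
Definition percolation_law (R : realType) (p : R)
    (P : probability config_space R) : Prop :=
  forall (F : {fset edge}) (b : edge -> bool),
    P [set o : config | forall e, e \in F -> o e = b e] =
    (\prod_(e <- F) (if b e then p else 1 - p))%:E.

Definition open_adj (o : config) : rel V :=
  fun x y => `[< exists e : edge, val e = [fset x; y]%fset /\ o e >].

Definition connection (x y : V) : set config_space :=
  [set o | linked (open_adj o) x y].

Section Triangle.
Context (R : realType) (P : probability config_space R).
Local Open Scope ereal_scope.

Definition triangle_sum (v w : V) : \bar R :=
  \esum_(z in [set: V * V])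
     (P (connection v z.1) * P (connection z.1 z.2) * P (connection z.2 w)).

Definition triangle_condition : Prop := exists v, triangle_sum v v < +oo.

(* 0 is added to the set so that the supremum is 0 (not -oo) when the ball is
   the whole graph. *)
Definition sup_outside_ball (v : V) (n : nat) : \bar R :=
  ereal_sup (0 |` [set triangle_sum v w | w in ~` gball v n]).

Definition open_triangle_condition : Prop :=
  forall v, sup_outside_ball v n @[n --> \oo] --> 0.

End Triangle.

End Graphs.

(* Main.v *)
Require Import Defs.
From mathcomp Require Import all_boot all_order all_algebra finmap ring lra.
From mathcomp Require Import all_classical all_reals all_analysis.
Import Order.TTheory GRing.Theory Num.Theory.
Import numFieldNormedType.Exports.

(** Write tau x y for the two-point function P (x <-> y) and T v w for the
    triangle sum.  Two properties of tau do the work.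

    - tau is positive semi-definite ([two_point_psd], Aizenman and Newman):
      for a finite family of weights f, the sum of the f x * f y * tau x y is the
      expectation of the sum over open clusters of the squared total weight of
      the cluster ([class_psd]).
    - tau is invariant under automorphisms of G, because a percolation law is
      determined by its values on cylinders ([relabel_invariant]).  By
      transitivity T w w is then a finite constant C.

    The rest is about kernels only ([three_step_vanishing]).  Keeping just the
    terms with x = v in T v v shows that the sum over y of (tau v y)^2 is at most
    C.  Hence tau y w tends to 0 as w leaves finite sets, for each fixed y
    ([tau_vanishing]).  The convolution of tau with itself tends to 0 as
    well ([two_step_vanishing]): restrict the intermediate vertex to a large
    finite set F, and bound the remainder by Cauchy-Schwarz in l^2, where one
    factor is the small tail of the row of x and the other is at most C.  For
    T v w, restrict the first intermediate vertex x to a finite set F.  The part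
    with x in F is a finite combination of convolutions, which tends to 0.  The
    other part is the inner product, for the form defined by tau, of the row of v
    restricted to the complement of F with the row of w; by Cauchy-Schwarz for
    this form it is small, since the first vector has squared norm bounded by a
    small tail of the convergent sum T v v ([small_corner]) and the second one
    has squared norm T w w <= C.

    Convergence along finite sets suffices: a finite set of vertices lies in some
    ball around v, so the complements of large balls avoid it. *)

Set Implicit Arguments.
Unset Strict Implicit.
Unset Printing Implicit Defensive.

Local Open Scope classical_set_scope.
Local Open Scope ring_scope.

(** * Convergence and finite sums *)

Lemma cvge0 (R : realType) (u : nat -> \bar R) :
  (forall n, 0 <= u n)%E ->
  (forall e, 0 < e -> exists n0, forall n, (n0 <= n)%N -> (u n <= e%:E)%E) ->
  u n @[n --> \oo] --> 0%E.
Proof.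
move=> u0 ue.
have ufin e n : (u n <= e%:E)%E -> u n \is a fin_num.
  by move=> une; rewrite ge0_fin_numE // (le_lt_trans une) // ltry.
apply/fine_cvgP; split.
  by have [n0 un0] := ue 1 ltr01; exists n0 => // n /= /un0; exact: ufin.
apply/cvgrPdist_le => e /ue[n0 un0]; exists n0 => // n /= /un0 une.
rewrite sub0r normrN ger0_norm ?fine_ge0 //.
by rewrite -lee_fin fineK // (ufin e).
Qed.

Section Sums.
Context (R : realType) (I : choiceType) (a : I -> R).

(** The supremum of the finite sums is nearly attained on some F, so that terms
    outside F can add almost nothing to it. *)
Lemma small_tail (C : R) : (forall s, uniq s -> \sum_(i <- s) a i <= C) ->
  forall e, 0 < e -> exists2 F : seq I, uniq F &
    forall s, uniq s -> \sum_(i <- s | i \notin F) a i <= e.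
Proof.
move=> aC e e0.
pose S := [set \sum_(i <- s) a i | s in [set s : seq I | uniq s]].
have supS : has_sup S.
  split; first by exists (\sum_(i <- [::]) a i), [::].
  by exists C => _ [s us <-]; exact: aC.
have [_ [F uF <-] ltF] := sup_adherent e0 supS.
exists F => // s us; rewrite -big_filter.
have uFs : uniq (F ++ [seq i <- s | i \notin F]).
  rewrite cat_uniq uF filter_uniq // andbT; apply/hasPn => i.
  by rewrite mem_filter => /andP[].
have : \sum_(i <- F ++ [seq i <- s | i \notin F]) a i <= sup S.
  apply: sup_upper_bound => //; first by exists (F ++ [seq i <- s | i \notin F]).
rewrite big_cat /=; lra.
Qed.

Hypothesis a_ge0 : forall i, 0 <= a i.

Lemma ler_sum_subset (s s' : seq I) : uniq s -> uniq s' -> {subset s <= s'} ->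
  \sum_(i <- s) a i <= \sum_(i <- s') a i.
Proof.
move=> us us' ss'.
have -> : \sum_(i <- s) a i = \sum_(i <- s' | i \in s) a i.
  rewrite -[RHS]big_filter; apply: perm_big; apply: uniq_perm => //.
    exact: filter_uniq.
  by move=> i; rewrite mem_filter; case: (boolP (i \in s)) => // /ss' ->.
by rewrite [leRHS](bigID (mem s)) /= lerDl sumr_ge0.
Qed.

End Sums.

Lemma uniq_pairs (T : eqType) (s : seq T) :
  uniq s -> uniq [seq (x, y) | x <- s, y <- s].
Proof. by move=> us; apply: allpairs_uniq => // -[? ?] [? ?] _ _ [-> ->]. Qed.

(** Lets a sum over a finite set of pairs be bounded by a double sum over one
    finite set. *)
Lemma subset_pairs (T : eqType) (s : seq (T * T)) :
  let E := undup ([seq z.1 | z <- s] ++ [seq z.2 | z <- s]) in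
  {subset s <= [seq (x, y) | x <- E, y <- E]}.
Proof.
move=> E [x y] xys; apply/allpairsP; exists (x, y).
by rewrite /E !mem_undup !mem_cat (map_f fst xys) (map_f snd xys) orbT.
Qed.

(** * Positive semi-definite kernels *)

Section Kernel.
Context (R : realType) (V : choiceType).

(** In the applications h E w is the partial sum over the finite set E of a series
    with nonnegative terms that depends on w.  As W does not depend on E, the bound
    passes to the full series, without infinite sums being handled. *)
Definition vanishing (h : seq V -> V -> R) : Prop :=
  forall e, 0 < e -> exists W : seq V,
    forall E w, uniq E -> w \notin W -> h E w <= e.

Lemma vanishing_approx (h : seq V -> V -> R) :
  (forall e, 0 < e -> exists2 h', vanishing h' &
     forall E w, uniq E -> h E w <= h' E w + e) ->
  vanishing h.
Proof.
move=> H e e0; have e20 : 0 < e / 2 by lra.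
have [h' vh' hh'] := H _ e20; have [W HW] := vh' _ e20.
exists W => E w uE wW; have := hh' E w uE; have := HW E w uE wW; lra.
Qed.

Lemma vanishing_sum (s : seq V) (c : V -> R) (h : V -> seq V -> V -> R) :
  (forall x, 0 <= c x <= 1) -> (forall x, vanishing (h x)) ->
  vanishing (fun E w => \sum_(x <- s) c x * h x E w).
Proof.
move=> c01 vh; elim: s => [|x s IHs] e e0.
  by exists [::] => E w _ _; rewrite big_nil ltW.
have e20 : 0 < e / 2 by lra.
have [W1 H1] := vh x _ e20; have [W2 H2] := IHs _ e20.
exists (W1 ++ W2) => E w uE; rewrite mem_cat negb_or => /andP[w1 w2].
have {}H1 := H1 _ _ uE w1; have {}H2 := H2 _ _ uE w2.
rewrite big_cons; have /andP[c0 c1] := c01 x; nra.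
Qed.

Variables (tau : V -> V -> R) (C : R).

Definition two_step (E : seq V) (x w : V) : R :=
  \sum_(y <- E) tau x y * tau y w.

Definition three_step (E : seq V) (v w : V) : R :=
  \sum_(x <- E) \sum_(y <- E) tau v x * tau x y * tau y w.

Lemma three_step_pairs (E : seq V) (v w : V) :
  three_step E v w = \sum_(z <- [seq (x, y) | x <- E, y <- E])
    tau v z.1 * tau z.1 z.2 * tau z.2 w.
Proof. by rewrite big_allpairs. Qed.

Hypothesis tau_sym : forall x y, tau x y = tau y x.
Hypothesis tau01 : forall x y, 0 <= tau x y <= 1.
Hypothesis tau_refl : forall x, tau x x = 1.
Hypothesis tau_psd : forall (E : seq V) (f : V -> R),
  0 <= \sum_(x <- E) \sum_(y <- E) f x * f y * tau x y.
Hypothesis C_gt0 : 0 < C.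
Hypothesis three_stepC : forall E v, uniq E -> three_step E v v <= C.

Let tau_ge0 x y : 0 <= tau x y. Proof. by case/andP: (tau01 x y). Qed.

(** The inequality of Cauchy-Schwarz for the form defined by tau, with a free
    parameter t in place of the square roots; it is the positivity of the form at
    t f - g. *)
Lemma young_tau (E : seq V) (f g : V -> R) (t : R) : 0 < t ->
  \sum_(x <- E) \sum_(y <- E) f x * g y * tau x y <=
    (t * (\sum_(x <- E) \sum_(y <- E) f x * f y * tau x y) +
     t^-1 * (\sum_(x <- E) \sum_(y <- E) g x * g y * tau x y)) / 2.
Proof.
move=> t0; have := tau_psd E (fun x => t * f x - g x).
set A := \sum_(x <- E) \sum_(y <- E) f x * f y * tau x y.
set B := \sum_(x <- E) \sum_(y <- E) g x * g y * tau x y.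
set D := \sum_(x <- E) \sum_(y <- E) f x * g y * tau x y.
have D' : D = \sum_(x <- E) \sum_(y <- E) g x * f y * tau x y.
  rewrite /D exchange_big /=; apply: eq_bigr => x _; apply: eq_bigr => y _.
  by rewrite tau_sym [f y * _]mulrC.
have -> : \sum_(x <- E) \sum_(y <- E)
    (t * f x - g x) * (t * f y - g y) * tau x y = t ^+ 2 * A - t * D - t * D + B.
  rewrite {2}D' /A /B /D !mulr_sumr -!sumrB -big_split /=.
  apply: eq_bigr => x _; rewrite !mulr_sumr -!sumrB -big_split /=.
  by apply: eq_bigr => y _; ring.
move=> H.
have tn0 : t != 0 by rewrite gt_eqF.
have -> : (t * A + t^-1 * B) / 2 =
   D + (t ^+ 2 * A - t * D - t * D + B) * (t^-1 / 2) by field.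
by rewrite lerDl mulr_ge0 // divr_ge0 // invr_ge0 ltW.
Qed.

(** Since tau x x = 1, the terms of the triangle sum at x whose first
    intermediate vertex is x are the squares of the row of x. *)
Lemma sum_sqr_le (E : seq V) (x : V) : uniq E -> \sum_(y <- E) tau x y ^+ 2 <= C.
Proof.
move=> uE; pose E' := undup (x :: E).
have uE' : uniq E' by exact: undup_uniq.
have xE' : x \in E' by rewrite mem_undup mem_head.
apply: le_trans (three_stepC x uE').
apply: (@le_trans _ _ (\sum_(y <- E') tau x y ^+ 2)).
  apply: ler_sum_subset => //; first by move=> y; exact: sqr_ge0.
  by move=> y yE; rewrite mem_undup inE yE orbT.
rewrite /three_step [leRHS](bigD1_seq x) //= ler_wpDr //.
  by rewrite sumr_ge0 // => y _; rewrite sumr_ge0 // => z _; rewrite !mulr_ge0.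
by apply: ler_sum => y _; rewrite tau_refl mul1r expr2 [tau y x]tau_sym.
Qed.

(** The row of y is square-summable, so only finitely many of its entries
    exceed e. *)
Lemma tau_vanishing (y : V) : vanishing (fun _ w => tau y w).
Proof.
move=> e e0; have e20 : 0 < e ^+ 2 by exact: exprn_gt0.
have [F _ HF] := small_tail (fun E uE => sum_sqr_le y uE) e20.
exists F => _ w _ wF; have := HF [:: w] isT.
by rewrite big_mkcond big_seq1 wF ler_pXn2r // nnegrE // ltW.
Qed.

(** A finite set F carries all but little of the l^2 norm of the row of x.  The
    terms with y in F vanish one by one; Cauchy-Schwarz controls the others by the
    tail of the row of x and the bounded l^2 norm of the row of w. *)
Lemma two_step_vanishing (x : V) : vanishing (fun E w => two_step E x w).
Proof.
apply: vanishing_approx => e e0.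
have d0 : 0 < e ^+ 2 / C by rewrite divr_gt0 // exprn_gt0.
have [F uF HF] := small_tail (fun E uE => sum_sqr_le x uE) d0.
exists (fun E w => \sum_(y <- F) tau x y * tau y w).
  by apply: (vanishing_sum F (tau01 x)); exact: tau_vanishing.
move=> E w uE; rewrite /two_step (bigID (mem F)) /= lerD //.
  rewrite -[leLHS]big_filter; apply: ler_sum_subset.
  - by move=> y; rewrite mulr_ge0.
  - exact: filter_uniq.
  - by [].
  - by move=> y; rewrite mem_filter => /andP[].
(* For this t, a tail e^2/C and a norm C contribute e/2 each. *)
pose t := C / e; have t0 : 0 < t by rewrite divr_gt0.
apply: (@le_trans _ _ (\sum_(y <- E | y \notin F)
   (t / 2 * tau x y ^+ 2 + t^-1 / 2 * tau w y ^+ 2))).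
  apply: ler_sum => y _; rewrite [tau y w]tau_sym -subr_ge0.
  have -> : t / 2 * tau x y ^+ 2 + t^-1 / 2 * tau w y ^+ 2 - tau x y * tau w y
     = t^-1 / 2 * (t * tau x y - tau w y) ^+ 2 by field; rewrite gt_eqF.
  by rewrite mulr_ge0 ?sqr_ge0 // divr_ge0 // invr_ge0 ltW.
rewrite big_split /= -!mulr_sumr.
have H1 := HF _ uE.
have H2 : \sum_(y <- E | y \notin F) tau w y ^+ 2 <= C.
  by rewrite -big_filter sum_sqr_le // filter_uniq.
have -> : e = t / 2 * (e ^+ 2 / C) + t^-1 / 2 * C.
  by rewrite /t; field; rewrite !gt_eqF.
by rewrite lerD // ler_wpM2l // divr_ge0 // ?invr_ge0 // ltW.
Qed.

(** The pairs with both coordinates outside F avoid a finite set of pairs that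
    carries almost all of the triangle sum at v. *)
Lemma small_corner (v : V) (e : R) : 0 < e -> exists2 F : seq V, uniq F &
  forall E, uniq E -> three_step [seq x <- E | x \notin F] v v <= e.
Proof.
move=> e0; pose a (z : V * V) := tau v z.1 * tau z.1 z.2 * tau z.2 v.
have a0 z : 0 <= a z by rewrite !mulr_ge0.
have aC (s : seq (V * V)) : uniq s -> \sum_(z <- s) a z <= C.
  move=> us; pose E := undup ([seq z.1 | z <- s] ++ [seq z.2 | z <- s]).
  have uE : uniq E by exact: undup_uniq.
  apply: le_trans (three_stepC v uE).
  rewrite three_step_pairs.
  apply: ler_sum_subset => //.
    exact: uniq_pairs.
  exact: subset_pairs.
have [F2 uF2 HF2] := small_tail aC e0.
exists (undup [seq z.1 | z <- F2]); first exact: undup_uniq.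
move=> E uE; set E' := [seq x <- E | _].
have uE' : uniq E' by exact: filter_uniq.
have uEE : uniq [seq (x, y) | x <- E', y <- E'].
  exact: uniq_pairs.
apply: le_trans (HF2 _ uEE).
rewrite three_step_pairs.
rewrite -[leRHS]big_filter (all_filterP _) //.
apply/allP => _ /allpairsP[[x y] [/= xE _ ->]].
apply/negP => xyF; move: xE; rewrite mem_filter mem_undup.
by rewrite (map_f fst xyF).
Qed.

(** Same scheme with the l^2 inner product replaced by the form defined by tau:
    the first intermediate vertex is either in a finite set F, which leaves a
    finite combination of convolutions, or outside it, and then [young_tau] bounds
    the sum by [small_corner] and by the diagonal triangle sum at w. *)
Lemma three_step_vanishing (v : V) : vanishing (fun E w => three_step E v w).
Proof.
apply: vanishing_approx => e e0.
have d0 : 0 < e ^+ 2 / C by rewrite divr_gt0 // exprn_gt0.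
have [F uF HF] := small_corner v d0.
exists (fun E w => \sum_(x <- F) tau v x * two_step E x w).
  by apply: (vanishing_sum F (tau01 v)); exact: two_step_vanishing.
move=> E w uE; rewrite /three_step (bigID (mem F)) /= lerD //.
  under eq_bigr => x _.
    under eq_bigr do rewrite -mulrA.
    rewrite -mulr_sumr -/(two_step E x w).
    over.
  rewrite -[leLHS]big_filter; apply: ler_sum_subset.
  - by move=> x; rewrite mulr_ge0 // sumr_ge0 // => y _; rewrite mulr_ge0.
  - exact: filter_uniq.
  - by [].
  - by move=> y; rewrite mem_filter => /andP[].
pose f x := (x \notin F)%:R * tau v x.
pose t := C / e; have t0 : 0 < t by rewrite divr_gt0.
have -> : \sum_(x <- E | x \notin F) \sum_(y <- E) tau v x * tau x y * tau y w
   = \sum_(x <- E) \sum_(y <- E) f x * tau w y * tau x y.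
  rewrite big_mkcond; apply: eq_bigr => x _; rewrite /f.
  case: ifP => _; last by rewrite mul0r big1 // => y _; rewrite !mul0r.
  by apply: eq_bigr => y _; rewrite mul1r [tau y w]tau_sym mulrAC.
have fE : \sum_(x <- E) \sum_(y <- E) f x * f y * tau x y <= e ^+ 2 / C.
  apply: le_trans (HF _ uE); rewrite le_eqVlt; apply/orP; left; apply/eqP.
  rewrite /three_step big_filter [RHS]big_mkcond; apply: eq_bigr => x _.
  rewrite /f big_filter [X in if _ then X else _]big_mkcond /=.
  case: ifP => _; last by rewrite big1 // => y _; rewrite !mul0r.
  apply: eq_bigr => y _; case: ifP => _; last by rewrite mul0r mulr0 mul0r.
  by rewrite !mul1r [tau y v]tau_sym mulrAC.
have wE : \sum_(x <- E) \sum_(y <- E) tau w x * tau w y * tau x y <= C.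
  apply: le_trans (three_stepC w uE); rewrite le_eqVlt; apply/orP; left.
  apply/eqP; apply: eq_bigr => x _; apply: eq_bigr => y _.
  by rewrite [tau y w]tau_sym mulrAC.
apply: le_trans (young_tau E f (tau w) t0) _.
have -> : e = (t * (e ^+ 2 / C) + t^-1 * C) / 2.
  by rewrite /t; field; rewrite !gt_eqF.
by rewrite ler_pM2r ?invr_gt0 // lerD // ler_wpM2l // ?invr_ge0 ltW.
Qed.

End Kernel.

(** * Open clusters and the two-point function *)

(** The form is the sum over the classes of the squared total weight of the
    class. *)
Lemma class_psd (R : realDomainType) (V : choiceType) (e : V -> V -> Prop)
    (E : seq V) (f : V -> R) :
  (forall x, e x x) -> (forall x y, e x y -> e y x) ->
  (forall x y z, e x y -> e y z -> e x z) ->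
  0 <= \sum_(x <- E) \sum_(y <- E) f x * f y * (`[< e x y >])%:R.
Proof.
move=> erefl esym etrans.
(* r x is a representative of the class of x, which depends on the class only. *)
pose r x := choose (fun y => `[< e x y >]) x.
have er x : e x (r x).
  by apply/asboolP; apply: (@chooseP _ (fun y => `[< e x y >])); apply/asboolP.
have rE x y : `[< e x y >] = (r x == r y).
  apply/idP/eqP => [/asboolP exy|rxy]; last first.
    apply/asboolP; apply: (etrans _ (r x)) (er x) _.
    by rewrite rxy; exact/esym/er.
  have exE : (fun z => `[< e x z >]) =1 (fun z => `[< e y z >]).
    move=> z; apply/asboolP/asboolP; first exact/etrans/esym.
    exact: etrans.
  rewrite /r (eq_choose exE); apply: choose_id; apply/asboolP => //.
  exact: esym.
have -> : \sum_(x <- E) \sum_(y <- E) f x * f y * (`[< e x y >])%:R =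
    \sum_(c <- undup (map r E)) (\sum_(x <- E) f x * (r x == c)%:R) ^+ 2.
  under [RHS]eq_bigr do rewrite expr2 mulr_suml.
  rewrite [RHS]exchange_big /=; apply: eq_big_seq => x xE.
  under [RHS]eq_bigr do rewrite mulr_sumr.
  rewrite [RHS]exchange_big /=; apply: eq_bigr => y _.
  rewrite (bigD1_seq (r x)) ?undup_uniq ?mem_undup ?map_f //= big1 ?addr0.
    by rewrite rE eqxx mulr1 mulrA [r y == _]eq_sym.
  by move=> c; rewrite eq_sym => /negbTE ->; rewrite mulr0 mul0r.
by apply: sumr_ge0 => c _; exact: sqr_ge0.
Qed.

(** The sum is the expectation of a nonnegative random variable. *)
Lemma sum_prob_ge0 d (T : measurableType d) (R : realType)
    (P : probability T R) (I : Type) (s : seq I) (c : I -> R) (A : I -> set T) :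
  (forall i, measurable (A i)) ->
  (forall t, 0 <= \sum_(i <- s) c i * \1_(A i) t) ->
  0 <= \sum_(i <- s) c i * fine (P (A i)).
Proof.
move=> mA cA.
have iA i : P.-integrable [set: T] (fun t => (\1_(A i) t)%:E).
  exact: integrable_indic.
have : (0 <= \int[P]_t \sum_(i <- s) (c i)%:E * (\1_(A i) t)%:E)%E.
  apply: integral_ge0 => t _.
  under eq_bigr do rewrite -EFinM.
  by rewrite sumEFin lee_fin; exact: cA.
rewrite integral_sum //; last by move=> i; apply: integrableZl.
rewrite -lee_fin -sumEFin; congr (_ <= _)%E; apply: eq_bigr => i _.
rewrite integralZl // integral_indic // setIT EFinM fineK //.
exact: fin_num_measure.
Qed.

Section Connections.
Context (V : countType) (G : graph V).
Implicit Types (o : config G) (x y z : V).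

Lemma open_adj_sym o : symmetric (open_adj o).
Proof. by move=> x y; rewrite /open_adj fsetUC. Qed.

Lemma linked_refl (r : rel V) x : linked r x x.
Proof. by exists [::]. Qed.

Lemma linked_trans (r : rel V) x y z : linked r x y -> linked r y z -> linked r x z.
Proof.
move=> [s [ps <-]] [t [pt <-]]; exists (s ++ t).
by split; rewrite ?cat_path ?ps ?last_cat.
Qed.

Lemma linked_sym (r : rel V) x y : symmetric r -> linked r x y -> linked r y x.
Proof.
move=> rC [s [ps <-]]; exists (rev (belast x s)); split.
  by rewrite rev_path -(eq_path rC).
by case: s ps => //= z s _; rewrite rev_cons last_rcons.
Qed.

Lemma connectionC x y : @connection V G x y = @connection V G y x.
Proof.
by apply/seteqP; split=> o /=; apply: linked_sym; exact: open_adj_sym.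
Qed.

Lemma connection_refl x : @connection V G x x = setT.
Proof. by apply/seteqP; split=> // o _; exact: linked_refl. Qed.

Lemma measurable_open (e : edge G) :
  measurable ([set o | o e] : set (config_space G)).
Proof. by apply: sub_sigma_algebra; exists e. Qed.

Lemma eq_measurable d (T : measurableType d) (A B : set T) :
  A `<=>` B -> measurable B -> measurable A.
Proof. by move=> /seteqP ->. Qed.

Lemma measurable_open_adj x y :
  measurable ([set o | open_adj o x y] : set (config_space G)).
Proof.
have [[e exy]|nexy] := pselect (exists e : edge G, val e = [fset x; y]%fset).
  apply: eq_measurable (measurable_open e).
  split=> o /= => [/asboolP[e' [e'xy oe']]|oe].
    by rewrite (_ : e = e') //; apply: val_inj; rewrite exy e'xy.
  by apply/asboolP; exists e.
apply: eq_measurable measurable0; split=> o //= /asboolP[e [exy _]].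
by apply: nexy; exists e.
Qed.

(** There are countably many walks, and a given walk is open exactly when
    finitely many edges are. *)
Lemma measurable_connection x y : measurable (@connection V G x y).
Proof.
have mpath s z : measurable ([set o | path (open_adj o) z s] : set (config_space G)).
  elim: s z => [|u s IHs] z /=; first exact: eq_measurable measurableT.
  apply: eq_measurable (measurableI _ _ (measurable_open_adj z u) (IHs u)).
  by split=> o /= => [/andP[]|[-> ->]].
pose ends s : set (config_space G) :=
  if last x s == y then [set o | path (open_adj o) x s] else set0.
have mends : measurable (\bigcup_(s : seq V) ends s).
  apply: countable_bigcupT_measurable; first exact: countableP.
  by move=> s; rewrite /ends; case: ifP => _; [exact: mpath|exact: measurable0].
apply: eq_measurable mends; split=> o /=.
  by move=> [s [ps lsy]]; exists s => //; rewrite /ends lsy eqxx.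
by move=> [s _]; rewrite /ends; case: eqP => // lsy ps; exists s.
Qed.

(** * Invariance under automorphisms *)

Lemma automorphism_inv f : automorphism G f ->
  exists g, [/\ automorphism G g, cancel f g & cancel g f].
Proof.
move=> [[g fK gK] fadj]; exists g; split=> //; split; first by exists f.
by move=> x y; rewrite -fadj !gK.
Qed.

Section Relabelling.
Variables (f : V -> V) (f_aut : automorphism G f).

Lemma edge_image_subproof (e : edge G) :
  `[< exists x y, adj G x y /\ (f @` val e)%fset = [fset x; y]%fset >].
Proof.
have /asboolP[x [y [xy ->]]] := valP e.
by apply/asboolP; exists (f x), (f y); rewrite (proj2 f_aut) imfset_fset2.
Qed.

Definition edge_image (e : edge G) : edge G :=
  exist _ (f @` val e)%fset (edge_image_subproof e).

Lemma val_edge_image (e : edge G) : val (edge_image e) = (f @` val e)%fset.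
Proof. by []. Qed.

Lemma edge_image_inj : injective edge_image.
Proof.
move=> e1 e2 /(congr1 val); rewrite !val_edge_image => fe12; apply: val_inj.
have [[g fK _] _] := f_aut.
have imK (A : {fset V}) : (g @` (f @` A) = A)%fset.
  rewrite -imfset_comp /=; apply/fsetP => x; apply/imfsetP/idP => /=.
    by move=> [y yA ->]; rewrite fK.
  by move=> xA; exists x => //; rewrite fK.
by rewrite -[LHS]imK fe12 imK.
Qed.

Definition relabel (o : config_space G) : config_space G := o \o edge_image.

Lemma measurable_relabel : measurable_fun setT relabel.
Proof.
apply: (@measurability _ _ (config_space G) (config_space G) setT relabel
  (@edge_events V G) erefl).
move=> _ [_ [e _ <-] <-]; rewrite setTI.
exact: (measurable_open (edge_image e)).
Qed.

End Relabelling.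

Lemma open_adj_relabel f (f_aut : automorphism G f) (o : config_space G) x y :
  open_adj (relabel f_aut o) x y = open_adj o (f x) (f y).
Proof.
apply/asboolP/asboolP.
  move=> [e [exy oe]]; exists (edge_image f_aut e); split=> //.
  by rewrite val_edge_image exy imfset_fset2.
move=> [e [exy oe]]; have [g [g_aut fK gK]] := automorphism_inv f_aut.
have gexy : val (edge_image g_aut e) = [fset x; y]%fset.
  by rewrite val_edge_image exy imfset_fset2 !fK.
exists (edge_image g_aut e); split=> //; rewrite /relabel /=.
rewrite (_ : edge_image f_aut _ = e) //; apply: val_inj.
by rewrite val_edge_image gexy imfset_fset2 exy.
Qed.

Lemma connection_relabel f (f_aut : automorphism G f) x y :
  relabel f_aut @^-1` @connection V G x y = @connection V G (f x) (f y).
Proof.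
have [g [g_aut fK gK]] := automorphism_inv f_aut.
have pathE (o : config_space G) s : path (open_adj (relabel f_aut o)) x s =
    path (open_adj o) (f x) (map f s).
  by rewrite path_map; apply: eq_path => u v; exact: open_adj_relabel.
apply/seteqP; split=> o /= [s [ps lsy]].
  exists (map f s); split; first by rewrite -pathE.
  by rewrite last_map lsy.
have fgs : map f (map g s) = s by rewrite -map_comp (eq_map gK) map_id.
exists (map g s); split; first by rewrite pathE fgs.
by rewrite -[x]fK last_map lsy fK.
Qed.

Definition cylinder (F : {fset edge G}) : set (config_space G) :=
  [set o | forall e, e \in F -> o e = true].

Section Law.
Context (R : realType) (p : R) (P : probability (config_space G) R).
Hypothesis P_law : percolation_law p P.

(** Relabelling maps cylinders of open edges to cylinders of as many open edges.
    These cylinders are stable under intersection and generate the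
    sigma-algebra, so they determine the law. *)
Lemma relabel_invariant f (f_aut : automorphism G f) (A : set (config_space G)) :
  measurable A -> P (relabel f_aut @^-1` A) = P A.
Proof.
move=> mA.
have mf := measurable_relabel f_aut.
have cylI : setI_closed [set cylinder F | F in [set: {fset edge G}]].
  move=> _ _ [F1 _ <-] [F2 _ <-]; exists (F1 `|` F2)%fset => //.
  apply/seteqP; split=> o /=.
    by move=> oF; split=> e eF; apply: oF; rewrite inE eF ?orbT.
  by move=> [ oF1 oF2] e; rewrite inE => /orP[/oF1|/oF2].
have mcyl : [set cylinder F | F in [set: {fset edge G}]] `<=` measurable.
  move=> _ [F _ <-].
  have := @fin_bigcap_measurable _ _ _ _ _ (finite_fset F)
    (fun e _ => measurable_open e).
  by apply: eq_measurable; split=> o oF e eF; exact: oF.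
have cyl0 : cylinder fset0 = setT by apply/seteqP; split=> o _ // e; rewrite inE.
apply: (@g_sigma_algebra_measure_unique _ _ _ _ mcyl (fun _ => setT) _ _
    (pushforward P (relabel f_aut)) P cylI).
- by move=> _; exists fset0.
- by apply/seteqP; split=> o _ //; exists 0%N.
- move=> _ [F _ <-]; rewrite /pushforward.
  transitivity (P (cylinder (edge_image f_aut @` F)%fset)).
    apply: (congr1 P); apply/seteqP; split=> o oF e.
      by move=> /imfsetP[e' e'F ->]; exact: (oF e' e'F).
    by move=> eF; apply: oF; apply/imfsetP; exists e.
  rewrite /cylinder !(P_law _ (fun=> true)) big_imfset //=.
  by move=> e1 e2 _ _; exact: edge_image_inj.
- move=> _; apply: (@le_lt_trans _ _ (P setT)); first exact: lexx.
  by rewrite probability_setT ltry.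
apply: sub_sigma_algebra2 mA => _ [e _ <-]; exists [fset e]%fset => //.
apply/seteqP; split=> o /=; first by apply; rewrite inE.
by move=> oe e'; rewrite inE => /eqP ->.
Qed.

Lemma connection_prob_invariant f x y : automorphism G f ->
  P (connection (f x) (f y)) = P (connection x y).
Proof.
move=> f_aut; rewrite -(connection_relabel f_aut) relabel_invariant //.
exact: measurable_connection.
Qed.

Lemma triangle_sum_invariant f v w : automorphism G f ->
  triangle_sum P (f v) (f w) = triangle_sum P v w.
Proof.
move=> f_aut; have [g [_ fK gK]] := automorphism_inv f_aut.
rewrite /triangle_sum (reindex_esum setT setT (fun z : V * V => (f z.1, f z.2))).
  by apply: eq_esum => z _ /=; rewrite !connection_prob_invariant.
split=> //.
- by move=> [a b] [c d] _ _ [/(can_inj fK) -> /(can_inj fK) ->].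
- by move=> [a b] _; exists (g a, g b); rewrite //= !gK.
Qed.

End Law.

(** * From the kernel to the triangle sums *)

Section TwoPoint.
Context (R : realType) (P : probability (config_space G) R).

Definition two_point (x y : V) : R := fine (P (connection x y)).

Lemma two_pointE x y : P (connection x y) = (two_point x y)%:E.
Proof. by rewrite fineK // fin_num_measure //; exact: measurable_connection. Qed.

Lemma two_pointC x y : two_point x y = two_point y x.
Proof. by rewrite /two_point connectionC. Qed.

Lemma two_point_refl x : two_point x x = 1.
Proof. by rewrite /two_point connection_refl probability_setT. Qed.

Lemma two_point01 x y : 0 <= two_point x y <= 1.
Proof.
rewrite -!lee_fin -two_pointE measure_ge0 probability_le1 //.
exact: measurable_connection.
Qed.

(** Being connected by open edges is an equivalence relation in every
    configuration, so [class_psd] holds pointwise and passes to expectations. *)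
Lemma two_point_psd (E : seq V) (f : V -> R) :
  0 <= \sum_(x <- E) \sum_(y <- E) f x * f y * two_point x y.
Proof.
rewrite [leRHS](_ : _ = \sum_(z <- [seq (x, y) | x <- E, y <- E])
  f z.1 * f z.2 * fine (P (connection z.1 z.2))); last by rewrite big_allpairs.
apply: sum_prob_ge0 => [z|o]; first exact: measurable_connection.
rewrite big_allpairs /=.
exact: (class_psd E f (@linked_refl (open_adj o))
  (fun x y => linked_sym (@open_adj_sym o)) (@linked_trans (open_adj o))).
Qed.

Lemma triangle_sum_le (v w : V) (c : R) :
  (forall E, uniq E -> three_step two_point E v w <= c) ->
  (triangle_sum P v w <= c%:E)%E.
Proof.
move=> sumc; apply: ub_ereal_sup => _ [A [fA _] <-].
rewrite fsbig_finite //=; set s : seq (V * V) := fset_set A.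
under eq_bigr do rewrite !two_pointE -!EFinM.
rewrite sumEFin lee_fin.
pose E : seq V := undup ([seq z.1 | z : V * V <- s] ++ [seq z.2 | z : V * V <- s]).
have uE : uniq E by exact: undup_uniq.
apply: le_trans (sumc E uE); rewrite three_step_pairs.
apply: (ler_sum_subset (a := fun z : V * V =>
  two_point v z.1 * two_point z.1 z.2 * two_point z.2 w)).
- by move=> z; rewrite !mulr_ge0 // /two_point fine_ge0.
- exact: fset_uniq.
- exact: uniq_pairs.
- exact: subset_pairs.
Qed.

Lemma three_step_le_triangle (E : seq V) (v w : V) : uniq E ->
  ((three_step two_point E v w)%:E <= triangle_sum P v w)%E.
Proof.
move=> uE; pose s := [seq (x, y) | x <- E, y <- E].
apply: esum_ge; exists [set` s]; first by split=> //; exact: finite_seq.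
rewrite -fsbig_seq; last exact: uniq_pairs.
rewrite three_step_pairs -sumEFin le_eqVlt; apply/orP; left; apply/eqP.
by apply: eq_bigr => z _; rewrite !two_pointE -!EFinM.
Qed.

Lemma sup_outside_ball_ge0 (v : V) (n : nat) : (0 <= sup_outside_ball P v n)%E.
Proof. by apply: ereal_sup_ubound; left. Qed.

Lemma gball_contains (v : V) (W : seq V) :
  exists n, forall w, w \in W -> gball G v n w.
Proof.
exists (\max_(w <- W) gdist G v w)%N => w wW.
by rewrite /gball /=; apply: (@leq_bigmax_seq _ W xpredT (gdist G v)).
Qed.

End TwoPoint.
End Connections.

Theorem mainTheorem1 (R : realType) (V : countType) (G : graph V)
    (p : R) (P : probability (config_space G) R) :
  connected_graph G ->
  vertex_transitive G ->
  0 <= p <= 1 ->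
  percolation_law p P ->
  triangle_condition P ->
  open_triangle_condition P.
Proof.
move=> _ G_trans _ P_law [v0 tri_v0] v.
(* Adding 1 makes C positive at once; the sum itself is at least 1. *)
pose tau := two_point P; pose C := fine (triangle_sum P v0 v0) + 1.
have tri_ge0 : (0 <= triangle_sum P v0 v0)%E.
  by apply: esum_ge0 => z _; rewrite !mule_ge0.
have C_gt0 : 0 < C by rewrite ltr_wpDl // fine_ge0.
have tauC E u : uniq E -> three_step tau E u u <= C.
  move=> uE; have [f [f_aut <-]] := G_trans v0 u.
  have := three_step_le_triangle P (f v0) (f v0) uE.
  rewrite (triangle_sum_invariant P_law) // => H.
  apply: (@le_trans _ _ (fine (triangle_sum P v0 v0))); last by rewrite /C lerDl.
  by rewrite -lee_fin fineK // ge0_fin_numE.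
have van := three_step_vanishing (two_pointC P) (two_point01 P)
  (two_point_refl P) (two_point_psd P) C_gt0 tauC v.
apply: cvge0 => [n|e e0]; first exact: sup_outside_ball_ge0.
have [W HW] := van e e0; have [n0 Wn0] := gball_contains G v W.
exists n0 => n n0n.
apply: ub_ereal_sup => x [->|[w wn <-]]; first by rewrite lee_fin ltW.
apply: triangle_sum_le => E uE; apply: HW => //.
apply/negP => /Wn0 /= ww; apply: wn; exact: leq_trans ww n0n.
Qed.
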